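(* Let $A$ be a commutative $\mathbb{F}_p$-algebra and $\delta=(\delta_1,\ldots,\delta_n)$ an $n$-tuple of pairwise commuting derivations of $A$. Let $d_1,\ldots,d_n\in\mathbb{N}\cup\{\infty\}$, $d=(d_1,\ldots,d_n)$, $I=\{\alpha\in\mathbb{N}^n\mid \alpha_i<p^{d_i}\ \forall i\}$. Suppose there are elements $y_{ik}\in A$ ($i=1,\ldots,n$; $k\in\mathbb{N}$, $k<d_i$) with $y_{ik}^p=0$, $\delta_i^{p^k}(y_{ik})=1$, and $\delta_j(y_{ik})=0$ for all $j\neq i$. For each $i$ let $\{x_i^{[j]}\mid 0\le j<p^{d_i}\}$ be the sequence obtained by the construction described in the context from the derivation $\delta_i$ and the elements $y_{i0},y_{i1},\ldots$. Then: (1) The family $\{x^{[\alpha]}:=x_1^{[\alpha_1]}\cdots x_n^{[\alpha_n]}\mid\alpha\in I\}$ is an iterative $\delta$-descent of exponent $d$. (2) Let $x'=\{x'^{[\alpha]}\mid\alpha\in I\}$ be any iterative $\delta$-descent of exponent $d$ in $A$. For each $i$, let $N_i=\{a\in A\mid \delta_i^{p^{d_i}}(a)=0\}$ (if $d_i=\infty$: the set of $a$ with $\delta_i^m(a)=0$ for some $m$) and $\mathfrak{m}_i=\bigoplus_{1\le j<p^{d_i}}A^{\delta_i}x'^{[je_i]}$, so that $N_i=A^{\delta_i}\oplus\mathfrak{m}_i$. For an iterative $\delta$-descent $y$ of exponent $d$, let $\lambda_{ij}(y)$ be the $A^{\delta_i}$-component of $y^{[p^je_i]}\in N_i$ ($0\le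 j<d_i$). Then $r_d:y\mapsto(\lambda_{ij}(y))_{i,j}$ is a bijection from the set of all iterative $\delta$-descents of exponent $d$ in $A$ onto $C(\delta,d)=\prod_{i=1}^n\{(\lambda_0,\lambda_1,\ldots,\lambda_{d_i-1})\mid \lambda_j\in A^\delta,\ \lambda_j^p=0\}$. (3) If in addition the ring $A^\delta=\bigcap_i\ker\delta_i$ is reduced, then the iterative $\delta$-descent in (1) is the only iterative $\delta$-descent of exponent $d$ in $A$.
   Context: For $\alpha\in\mathbb{N}^n$, $\delta^\alpha=\delta_1^{\alpha_1}\cdots\delta_n^{\alpha_n}$, $e_i$ the standard basis vectors, $A^{\delta_i}=\ker\delta_i$. A family $\{y^{[\alpha]}\mid\alpha\in I\}$ in $A$ is a $\delta$-descent if $y^{[0]}=1$ and $\delta^\alpha(y^{[\beta]})=y^{[\beta-\alpha]}$ for all $\alpha\in\mathbb{N}^n$, $\beta\in I$, where $y^{[\gamma]}:=0$ for $\gamma\notin\mathbb{N}^n$. It is iterative if $y^{[\alpha]}y^{[\beta]}=\binom{\alpha+\beta}{\beta}y^{[\alpha+\beta]}$ for all $\alpha,\beta\in I$, with $\binom{\alpha+\beta}{\beta}=\prod_i\binom{\alpha_i+\beta_i}{\beta_i}\in\mathbb{F}_p$ (the right side being $0$ when $\alpha+\beta\notin I$, in which case the coefficient vanishes mod $p$). An iterative $\delta$-descent indexed by $I$ has exponent $d$. Construction (for a derivation $\partial$ of $A$ and $y_0,\ldots,y_{e-1}$ with $y_k^p=0$, $\partial^{p^k}(y_k)=1$): $x^{[0]}=1$,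 $x^{[1]}=y_0$, $x^{[p]}=(-1)^{p-1}\phi_0(y_1)$ where $\phi_0(z)=\sum_{j=0}^{p-1}(-1)^j\frac{(x^{[1]})^j}{j!}\partial^j(z)$; recursively for $1\le k\le e-2$ (all $k\ge1$ if $e=\infty$), $x^{[p^{k+1}]}=(-1)^{p-1}\partial^{p^k-1}\Big(\prod_{l=0}^{k-1}\frac{(x^{[p^l]})^{p-1}}{(p-1)!}\cdot\phi_k(y_{k+1})\Big)$ with $\phi_k(z)=\sum_{j=0}^{p-1}(-1)^j\frac{(x^{[p^k]})^j}{j!}\partial^{p^kj}(z)$; and for $i=\sum_k i_kp^k$ ($0\le i_k<p$), $i<p^e$, $x^{[i]}=\prod_k\frac{(x^{[p^k]})^{i_k}}{i_k!}$. *)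

(* Defs.v *)
From HB Require Import structures.
From mathcomp Require Import all_boot all_order all_algebra.
Set Implicit Arguments. Unset Strict Implicit. Unset Printing Implicit Defensive.
Import Order.TTheory GRing.Theory.
Local Open Scope ring_scope.

(* Multi-indices alpha in N^n are finite functions 'I_n -> nat.
   Exponents d_i in N u {oo} are [option nat]: [Some e] = e, [None] = oo. *)
Definition mindex (n : nat) := {ffun 'I_n -> nat}.

Section Defs.
Variables (A : comPzRingType) (p n : nat).

Definition below_pexp (d : option nat) (m : nat) : bool :=
  if d is Some e then (m < p ^ e)%N else true.
Definition below (d : option nat) (k : nat) : bool :=
  if d is Some e then (k < e)%N else true.

Definition inI (d : 'I_n -> option nat) (al : mindex n) : bool :=
  [forall i, below_pexp (d i) (al i)].

Definition is_derivation (D : A -> A) : Prop :=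
  (forall a b, D (a + b) = D a + D b) /\ (forall a b, D (a * b) = a * D b + D a * b).

Definition dpow (dl : 'I_n -> A -> A) (al : mindex n) : A -> A :=
  foldr (fun i f => iter (al i) (dl i) \o f) id (enum 'I_n).

Definition mi0 : mindex n := [ffun => 0%N].
Definition miadd (al be : mindex n) : mindex n := [ffun i => (al i + be i)%N].
Definition misub (be al : mindex n) : mindex n := [ffun i => (be i - al i)%N].
Definition mile (al be : mindex n) : bool := [forall i, (al i <= be i)%N].
Definition miunit (i : 'I_n) (m : nat) : mindex n :=
  [ffun j => if j == i then m else 0%N].
Definition mibinom (al be : mindex n) : A :=
  (\prod_(i < n) 'C(al i + be i, be i))%:R.

(* A family indexed by I is represented as y : mindex n -> A, normalized by
   y alpha = 0 for alpha outside I (this also realizes y^[gamma] := 0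
   for gamma outside I / outside N^n in the defining identities). *)
Definition is_descent (dl : 'I_n -> A -> A) (d : 'I_n -> option nat)
  (y : mindex n -> A) : Prop :=
  [/\ forall al, ~~ inI d al -> y al = 0,
      y mi0 = 1 &
      forall al be, inI d be ->
        dpow dl al (y be) = if mile al be then y (misub be al) else 0].

Definition is_iterative (d : 'I_n -> option nat) (y : mindex n -> A) : Prop :=
  forall al be, inI d al -> inI d be ->
    y al * y be = mibinom al be * y (miadd al be).

Definition iter_descent dl d y := is_descent dl d y /\ is_iterative d y.

(* 1/j! in an F_p-algebra, j < p: the image of (j!)^(p-2), an inverse of j!
   modulo p by Fermat's little theorem. *)
Definition invfact (j : nat) : A := ((j`!) ^ (p - 2))%:R.

Definition phi (D : A -> A) (xk : A) (k : nat) (z : A) : A :=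
  \sum_(j < p) (-1) ^+ j * xk ^+ j * invfact j * iter (p ^ k * j) D z.

(* xps k = [:: x^[p^0]; x^[p^1]; ...; x^[p^k]] (course-of-values recursion) *)
Fixpoint xps (D : A -> A) (yk : nat -> A) (k : nat) : seq A :=
  match k with
  | 0 => [:: yk 0%N]
  | k'.+1 =>
      let s := xps D yk k' in
      rcons s
        ((-1) ^+ (p - 1) *
         iter (p ^ k' - 1) D
           ((\prod_(l < k') (nth 0 s l ^+ (p - 1) * invfact (p - 1)))
              * phi D (nth 0 s k') k' (yk k'.+1)))
  end.

Definition xp (D : A -> A) (yk : nat -> A) (k : nat) : A := nth 0 (xps D yk k) k.

(* x^[i] = prod_k (x^[p^k])^(i_k) / i_k!,  i = sum_k i_k p^k (base-p digits;
   digits of index >= i are zero) *)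
Definition xdiv (D : A -> A) (yk : nat -> A) (i : nat) : A :=
  \prod_(k < i.+1) (xp D yk k ^+ ((i %/ p ^ k) %% p) * invfact ((i %/ p ^ k) %% p)).

Definition xfam (dl : 'I_n -> A -> A) (d : 'I_n -> option nat)
  (Y : 'I_n -> nat -> A) (al : mindex n) : A :=
  if inI d al then \prod_(i < n) xdiv (dl i) (Y i) (al i) else 0.

Definition inN (dl : 'I_n -> A -> A) (d : 'I_n -> option nat) (i : 'I_n) (a : A) : Prop :=
  if d i is Some e then iter (p ^ e) (dl i) a = 0
  else exists m, iter m (dl i) a = 0.

Definition good_coef (dl : 'I_n -> A -> A) (d : 'I_n -> option nat) (i : 'I_n)
  (c : nat -> A) (N : nat) : Prop :=
  [/\ forall j, dl i (c j) = 0,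
      forall j, (N <= j)%N -> c j = 0 &
      forall j, ~~ below_pexp (d i) j -> c j = 0].

Definition lincomb (x' : mindex n -> A) (i : 'I_n) (c : nat -> A) (N : nat) : A :=
  \sum_(j < N) c j * x' (miunit i j).

(* c is the A^{delta_i}-component of y^[p^j e_i] in N_i = A^{delta_i} (+) m_i,
   m_i = (+)_{1 <= j < p^(d_i)} A^{delta_i} x'^[j e_i] *)
Definition lambda_rel dl d (x' : mindex n -> A) (i : 'I_n) (j : nat)
  (y : mindex n -> A) (c : A) : Prop :=
  dl i c = 0 /\
  exists cf N, [/\ good_coef dl d i cf N, cf 0%N = c &
                   y (miunit i (p ^ j)) = lincomb x' i cf N].

End Defs.

(* Main.v *)
Require Import Defs.
From mathcomp Require Import all_boot all_order all_algebra all_solvable ring zify.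
Set Implicit Arguments. Unset Strict Implicit. Unset Printing Implicit Defensive.
Import GRing.Theory.
Local Open Scope ring_scope.

(** An iterative descent is a product of its restrictions to the coordinate
    axes, which are sequences of divided powers [X j] with [D (X j.+1) = X j].
    By Lucas' theorem such a sequence amounts to elements [x k = X (p ^ k)] with
    [x k ^+ p = 0] and [D (x k) = \prod_(l < k) x l ^+ (p - 1) / (p - 1)!].
    The construction of [xp] produces such elements: [D] telescopes through
    [phi], and Frobenius kills every term of the Leibniz expansion.
    Relative to a fixed sequence [X], the constant term of [a] is
    [\sum_m (-1) ^+ m * X m * D^m a], while
    [\sum_m (-1) ^+ m * X m.+1 * D^m a] is an antiderivative of [a] with zero
    constant term and zero [p]-th power.  Hence [x k] is determined by
    [x 0], ..., [x (k - 1)] up to its constant term, which can be any constant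
    [c] with [c ^+ p = 0]. *)

(** Pascal's rule summed against [F], in the shape needed by the induction for the general Leibniz
    formula. *)
Lemma pascal_sum (A : pzRingType) (F : nat -> A) m :
  \sum_(j < m.+2) 'C(m.+1, j)%:R * F j = \sum_(j < m.+1) 'C(m, j)%:R * (F j.+1 + F j).
Proof.
rewrite big_ord_recl /=.
under eq_bigr => j _ do rewrite /bump /= add1n binS natrD mulrDl.
under [RHS]eq_bigr => j _ do rewrite mulrDr.
rewrite !big_split /= [X in _ + (X + _) = _]big_ord_recr /= (@bin_small m m.+1) // mul0r addr0.
rewrite [X in _ = _ + X]big_ord_recl /= !bin0 addrA [RHS]addrC.
by congr (_ + _ + _); apply: eq_bigr => i _; rewrite /bump /= add1n.
Qed.

(** * Derivations: Leibniz formula and integration by parts *)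

Section Derivations.
Variables (A : comPzRingType) (D : A -> A).
Hypothesis Dder : is_derivation D.

Lemma derD a b : D (a + b) = D a + D b. Proof. by case: Dder. Qed.
Lemma derM a b : D (a * b) = a * D b + D a * b. Proof. by case: Dder. Qed.

Lemma der0 : D 0 = 0.
Proof. by apply: (addrI (D 0)); rewrite -derD !addr0. Qed.

Lemma der1 : D 1 = 0.
Proof. by apply: (addrI (D 1)); rewrite -{3}[1]mulr1 derM mulr1 mul1r addr0. Qed.

Lemma derN a : D (- a) = - D a.
Proof. by apply: (addrI (D a)); rewrite -derD !subrr der0. Qed.

Lemma der_sum I (r : seq I) (P : pred I) F :
  D (\sum_(i <- r | P i) F i) = \sum_(i <- r | P i) D (F i).
Proof. exact: (big_morph D derD der0). Qed.

Lemma der_nat m : D m%:R = 0.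
Proof. by elim: m => [|m IH]; rewrite ?der0 // mulrS derD IH der1 addr0. Qed.

Lemma derMc c a : D c = 0 -> D (c * a) = c * D a.
Proof. by move=> c0; rewrite derM c0 mul0r addr0. Qed.

Lemma derM_eq0 a b : D a = 0 -> D b = 0 -> D (a * b) = 0.
Proof. by move=> a0 b0; rewrite derMc // b0 mulr0. Qed.

Lemma derX_eq0 a m : D a = 0 -> D (a ^+ m) = 0.
Proof.
by move=> a0; elim: m => [|m IH]; rewrite ?der1 // exprS derM_eq0.
Qed.

Lemma der_sign m : D ((-1) ^+ m) = 0.
Proof. by rewrite derX_eq0 // derN der1 oppr0. Qed.

Lemma der_prod_eq0 I (r : seq I) (P : pred I) F :
  (forall i, P i -> D (F i) = 0) -> D (\prod_(i <- r | P i) F i) = 0.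
Proof.
move=> h; apply: (big_ind (fun z => D z = 0)) => //; first exact: der1.
exact: derM_eq0.
Qed.

Lemma der_sum_eq0 I (r : seq I) (P : pred I) F :
  (forall i, P i -> D (F i) = 0) -> D (\sum_(i <- r | P i) F i) = 0.
Proof. by move=> h; rewrite der_sum big1. Qed.

Lemma derX a m : D (a ^+ m.+1) = m.+1%:R * a ^+ m * D a.
Proof.
elim: m => [|m IH]; first by rewrite expr1 expr0; ring.
by rewrite exprS derM IH (exprS a m) (mulrS 1 m.+1); ring.
Qed.

Lemma iter_deriv0 m : iter m D 0 = 0.
Proof. by elim: m => //= m ->; rewrite der0. Qed.

Lemma iter_derivD m a b : iter m D (a + b) = iter m D a + iter m D b.
Proof. by elim: m a b => //= m IH a b; rewrite IH derD. Qed.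

Lemma iter_derivN m a : iter m D (- a) = - iter m D a.
Proof. by elim: m => //= m ->; rewrite derN. Qed.

Lemma iter_deriv_sum m I (r : seq I) (P : pred I) F :
  iter m D (\sum_(i <- r | P i) F i) = \sum_(i <- r | P i) iter m D (F i).
Proof. exact: (big_morph _ (iter_derivD m) (iter_deriv0 m)). Qed.

Lemma iter_derivMc m c a : D c = 0 -> iter m D (c * a) = c * iter m D a.
Proof. by move=> c0; elim: m => //= m ->; rewrite derMc. Qed.

Lemma iter_deriv_ge m k a : (m <= k)%N -> iter m D a = 0 -> iter k D a = 0.
Proof. by move=> /subnK <- h; rewrite iterD h iter_deriv0. Qed.

Lemma iter_deriv_const m c : D c = 0 -> (0 < m)%N -> iter m D c = 0.
Proof. by move=> c0 m0; apply: (@iter_deriv_ge 1). Qed.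

Lemma iter_derivM m a b :
  iter m D (a * b) = \sum_(j < m.+1) 'C(m, j)%:R * (iter j D a * iter (m - j) D b).
Proof.
elim: m => [|m IH]; first by rewrite big_ord1 /= bin0; ring.
rewrite (pascal_sum (fun j => iter j D a * iter (m.+1 - j) D b)) [LHS]/= IH der_sum.
apply: eq_bigr => j _; rewrite (derMc _ (der_nat _)) derM addrC.
by rewrite subSS subSn // -ltnS.
Qed.

(* Repeated integration by parts: the intermediate terms telescope. *)
Lemma der_by_parts (u : nat -> A) z M :
  (forall m, (m < M)%N -> D (u m.+1) = u m) ->
  D (\sum_(m < M.+1) (-1) ^+ m * u m * iter m D z)
  = D (u 0%N) * z + (-1) ^+ M * u M * iter M.+1 D z.
Proof.
elim: M => [|M IH] hu.
  by rewrite big_ord1 /= expr0 !mul1r derM addrC.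
rewrite big_ord_recr /= derD IH => [|m hm]; last by apply: hu; lia.
rewrite derM derM der_sign hu //= exprS; ring.
Qed.

Lemma iter_commute (E : A -> A) m a :
  (forall b, D (E b) = E (D b)) -> D (iter m E a) = iter m E (D a).
Proof. by move=> c; elim: m => //= m <-; rewrite c. Qed.

End Derivations.

(** * Factorials and binomials in characteristic [p] *)

Section Characteristic.
Variables (A : comPzRingType) (p : nat).
Hypotheses (p_prime : prime p) (charA : p%:R = 0 :> A).

Lemma natr_modp (m k : nat) : m = k %[mod p] -> m%:R = k%:R :> A.
Proof.
move=> h; rewrite (divn_eq m p) (divn_eq k p) h.
by rewrite !natrD !natrM charA !mulr0.
Qed.

Lemma natr_dvdp m : (p %| m)%N -> m%:R = 0 :> A.
Proof. by move/eqP=> h; apply: (@natr_modp m 0); rewrite h mod0n. Qed.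

Lemma exprDp (a b : A) : (a + b) ^+ p = a ^+ p + b ^+ p.
Proof.
rewrite exprDn -(prednK (prime_gt0 p_prime)) big_ord_recl big_ord_recr /=.
rewrite prednK ?prime_gt0 // big1 => [|i _].
  rewrite /bump /= add1n prednK ?prime_gt0 // add0r subn0 bin0 binn subnn !expr0.
  by rewrite mulr1 mul1r !mulr1n.
rewrite -mulr_natr natr_dvdp ?mulr0 // prime_dvd_bin // /bump /= add1n.
by have := ltn_ord i; have := prime_gt0 p_prime; lia.
Qed.

Lemma sum_exprp I (r : seq I) (P : pred I) (F : I -> A) :
  (\sum_(i <- r | P i) F i) ^+ p = \sum_(i <- r | P i) F i ^+ p.
Proof.
apply: (big_morph (fun x => x ^+ p) exprDp).
by rewrite expr0n; case: p p_prime.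
Qed.

(** Euler's theorem applies because [p] does not divide the factorial of any [j < p]. *)
Lemma invfactK j : (j < p)%N -> j`!%:R * invfact A p j = 1.
Proof.
move=> jp; rewrite /invfact -natrM -expnS.
rewrite -subSn ?prime_gt1 // subSS subn1 -totient_prime //.
rewrite (natr_modp (k := 1)) // Euler_exp_totient // coprime_sym prime_coprime //.
elim: j jp => [|j IH] jp; first by rewrite dvdn1 neq_ltn prime_gt1 ?orbT.
by rewrite factS Euclid_dvdM // gtnNdvd //= IH // ltnW.
Qed.

Lemma invfact0 : invfact A p 0 = 1.
Proof. by rewrite /invfact exp1n. Qed.

Lemma invfact1 : invfact A p 1 = 1.
Proof. by rewrite /invfact exp1n. Qed.

Lemma invfactS j : (j.+1 < p)%N -> j.+1%:R * invfact A p j.+1 = invfact A p j.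
Proof.
move=> jp; have := invfactK jp; have := invfactK (ltnW jp); rewrite factS natrM.
move: (invfact _ _ _) (invfact _ _ _) => b a h1 h2.
transitivity (j.+1%:R * b * (j`!%:R * a)); first by rewrite h1 mulr1.
by transitivity (a * (j.+1%:R * j`!%:R * b)); [ring | rewrite h2 mulr1].
Qed.

Lemma invfactM i j : (i + j < p)%N ->
  invfact A p i * invfact A p j = 'C(i + j, j)%:R * invfact A p (i + j).
Proof.
move=> ijp; have [ip jp] : (i < p)%N /\ (j < p)%N by lia.
have := invfactK ip; have := invfactK jp; have := invfactK ijp.
have := bin_fact (leq_addl i j); rewrite addnK => <-; rewrite !natrM.
move: (invfact A p i) (invfact A p j) (invfact A p (i + j)) => a b c hc hb ha.
transitivity (a * b * ('C(i + j, j)%:R * (j`!%:R * i`!%:R) * c)).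
  by rewrite hc mulr1.
transitivity ('C(i + j, j)%:R * c * (i`!%:R * a) * (j`!%:R * b)); first by ring.
by rewrite ha hb !mulr1.
Qed.

(** From [m * 'C(p ^ k, m) = p ^ k * 'C(p ^ k - 1, m - 1)]: a binomial prime to [p] would make
    [p ^ k] divide the smaller number [m]. *)
Lemma dvdp_bin_pexp k m : (0 < m < p ^ k)%N -> (p %| 'C(p ^ k, m))%N.
Proof.
case: m => // m /andP[_ mk]; apply/negPn/negP => ndv.
have := dvdn_mulr 'C((p ^ k).-1, m) (dvdnn (p ^ k)).
rewrite mul_bin_diag Gauss_dvdl; last by rewrite coprimeXl // prime_coprime.
by move/(dvdn_leq (ltn0Sn m)); lia.
Qed.

(** Lucas' congruence with the digits cut at position [k]. Pascal's rule gives it by induction on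
    [b] and then [a]; the only input is that [p] divides the inner binomials of [p ^ k]. *)
Lemma natr_lucas k a b a' b' : (a < p ^ k)%N -> (a' < p ^ k)%N ->
  'C(a + b * p ^ k, a' + b' * p ^ k)%:R = 'C(a, a')%:R * 'C(b, b')%:R :> A.
Proof.
have := @dvdp_bin_pexp k; move: (p ^ k)%N => q hq.
elim: b a a' b' => [|b IHb]; elim=> [|a IHa] a' b' aq a'q.
- rewrite -natrM; congr (_%:R); rewrite !bin0n; nia.
- case: b' => [|b']; first by rewrite !mul0n !addn0 bin0 mulr1.
  by rewrite mul0n addn0 bin0n mulr0 bin_small //; nia.
(* Here [0 + b.+1 * q] is the successor of [q.-1 + b * q], so Pascal's rule passes from [b.+1] to
   [b]. *)
- have q1 : (q.-1 + b * q).+1 = (0 + b.+1 * q)%N by nia.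
  rewrite -q1; case: a' a'q => [|a'] a'q.
    case: b' => [|b']; first by rewrite !bin0 mulr1.
    have -> : (0 + b'.+1 * q = (q.-1 + b' * q).+1)%N by nia.
    rewrite binS natrD !IHb; try lia.
    have -> : ((q.-1 + b' * q).+1 = 0 + b'.+1 * q)%N by nia.
    by rewrite IHb ?binn ?bin0 ?binS ?natrD ?mul1r //; lia.
  (* The two terms combine to a multiple of ['C(q, a'.+1)], which is zero modulo [p]. *)
  rewrite addSn binS natrD -addSn !IHb; try lia.
  rewrite -mulrDl -natrD -binS prednK; last lia.
  by rewrite natr_dvdp ?hq // bin0n /= !mul0r.
rewrite addSn; case: a' a'q => [|a'] a'q.
  case: b' => [|b']; first by rewrite !bin0 mulr1.
  have e : (0 + b'.+1 * q = (q.-1 + b' * q).+1)%N by nia.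
  rewrite {1}e binS natrD -e !IHa; try lia.
  by rewrite (@bin_small a q.-1) ?mul0r ?addr0 ?bin0 //; lia.
by rewrite addSn binS natrD -addSn !IHa ?binS ?natrD ?mulrDl //; lia.
Qed.

End Characteristic.

(** * Index bounds for finite and infinite exponents *)

Section Bounds.
Variables (p : nat) (p_prime : prime p) (d : option nat).

Lemma below_pexpW m k : (m <= k)%N -> below_pexp p d k -> below_pexp p d m.
Proof. by case: d => //= e; apply: leq_ltn_trans. Qed.

Lemma below_pexp0 : below_pexp p d 0.
Proof. by case: d => //= e; rewrite expn_gt0 prime_gt0. Qed.

Lemma below_pexp_exp k : below_pexp p d (p ^ k) = below d k.
Proof. by case: d => //= e; rewrite ltn_exp2l // prime_gt1. Qed.

Lemma belowW m k : (m <= k)%N -> below d k -> below d m.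
Proof. by case: d => //= e; apply: leq_ltn_trans. Qed.

Lemma below_pexp_digit m k : below_pexp p d m -> (p ^ k <= m)%N -> below d k.
Proof. by move=> dm km; rewrite -below_pexp_exp (below_pexpW km). Qed.

End Bounds.

(** * Divided powers built from base-[p] digits *)

Section DigitProducts.
Variables (A : comPzRingType) (p : nat).
Hypotheses (p_prime : prime p) (charA : p%:R = 0 :> A).
Implicit Types (x : nat -> A) (D : A -> A).

Let p_gt0 : (0 < p)%N := prime_gt0 p_prime.
Let p_gt1 : (1 < p)%N := prime_gt1 p_prime.

(** The number [K] of digits is a parameter to allow induction on the top digit; by [divpowE] its
    choice is immaterial once [i < p ^ K]. *)
Definition digit_prod x (K i : nat) : A :=
  \prod_(k < K) (x k ^+ ((i %/ p ^ k) %% p) * invfact A p ((i %/ p ^ k) %% p)).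

(* [xdiv p D yk] is convertible to [divpow (xp p D yk)]. *)
Definition divpow x (i : nat) : A := digit_prod x i.+1 i.

Lemma digit_prodD x K m i : (i < p ^ K)%N -> digit_prod x (K + m) i = digit_prod x K i.
Proof.
move=> iK; elim: m => [|m IH]; first by rewrite addn0.
rewrite addnS /digit_prod big_ord_recr /= -/(digit_prod _ _ _) IH.
rewrite divn_small ?mod0n ?expr0 ?invfact0 ?mulr1 //.
by apply: leq_trans iK _; rewrite leq_exp2l // leq_addr.
Qed.

Lemma divpowE x K i : (i < p ^ K)%N -> divpow x i = digit_prod x K i.
Proof.
move=> iK; rewrite -(digit_prodD x i.+1 iK) addnC digit_prodD //.
by apply: leq_trans (ltn_expl _ p_gt1) _; rewrite leq_exp2l.
Qed.

Lemma divpow0 x : divpow x 0 = 1.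
Proof. by rewrite (@divpowE _ 0) // /digit_prod big_ord0. Qed.

Lemma divpow_recr x K a b : (a < p ^ K)%N -> (b < p)%N ->
  divpow x (a + b * p ^ K) = divpow x a * (x K ^+ b * invfact A p b).
Proof.
move=> aK bp; have q0 : (0 < p ^ K)%N by rewrite expn_gt0 p_gt0.
rewrite (@divpowE _ K.+1); last by rewrite expnS; nia.
rewrite (divpowE _ aK) /digit_prod big_ord_recr /=; congr (_ * _); last first.
  by rewrite addnC divnMDl // divn_small // addn0 modn_small.
apply: eq_bigr => k _; suff -> : ((a + b * p ^ K) %/ p ^ k = a %/ p ^ k %[mod p])%N by [].
(* For [k < K] the top contribution is a multiple of [p ^ k.+1], so digit [k] does not see it. *)
have e : (b * p ^ K = b * p ^ (K - k.+1) * p * p ^ k)%N.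
  by rewrite -!mulnA -expnS -expnD subnK.
by rewrite e addnC divnMDl ?expn_gt0 ?p_gt0 // modnMDl.
Qed.

Lemma divpow_exp x K : divpow x (p ^ K) = x K.
Proof.
have := @divpow_recr x K 0 1; rewrite add0n mul1n => -> //; last by rewrite expn_gt0 p_gt0.
by rewrite divpow0 expr1 invfact1 !mul1r mulr1.
Qed.

(** All [K] digits of [p ^ K - 1] equal [p - 1]; this identifies the product in the recursion for
    [xp]. *)
Lemma divpow_pred x K :
  divpow x (p ^ K - 1) = \prod_(l < K) (x l ^+ (p - 1) * invfact A p (p - 1)).
Proof.
elim: K => [|K IH]; first by rewrite subnn divpow0 big_ord0.
have q0 : (0 < p ^ K)%N by rewrite expn_gt0 p_gt0.
have -> : (p ^ K.+1 - 1 = (p ^ K - 1) + (p - 1) * p ^ K)%N.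
  by rewrite expnS mulnBl mul1n; have := leq_pmull (p ^ K) p_gt0; lia.
by rewrite divpow_recr ?IH ?big_ord_recr //=; lia.
Qed.

Lemma expr_ge (a : A) m k : (m <= k)%N -> a ^+ m = 0 -> a ^+ k = 0.
Proof. by move=> /subnK <- h; rewrite exprD h mulr0. Qed.

Lemma digit_decomp K i : (i < p ^ K.+1)%N ->
  exists a b, [/\ (a < p ^ K)%N, (b < p)%N & i = (a + b * p ^ K)%N].
Proof.
move=> iK; exists (i %% p ^ K)%N, (i %/ p ^ K)%N; split.
- by rewrite ltn_pmod // expn_gt0 p_gt0.
- by rewrite ltn_divLR ?expn_gt0 ?p_gt0 // -expnS.
- by rewrite addnC -divn_eq.
Qed.

(** Induction on the number of digits, splitting off the top one. Without a carry, Lucas' theorem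
    multiplies the binomials of the two parts; a top digit sum of at least [p] meets
    [x K ^+ p = 0]. *)
Lemma divpowM x K : (forall k, (k < K)%N -> x k ^+ p = 0) ->
  forall i j, (i < p ^ K)%N -> (j < p ^ K)%N -> divpow x i * divpow x j =
    if (i + j < p ^ K)%N then 'C(i + j, j)%:R * divpow x (i + j) else 0.
Proof.
elim: K => [|K IH] xp i j.
  rewrite !ltnS !leqn0 => /eqP -> /eqP ->.
  by rewrite divpow0 bin0 !mulr1.
move=> /digit_decomp[a [b [aK bp ->]]] /digit_decomp[a' [b' [a'K b'p ->]]].
have {}IH := IH (fun k kK => xp k (ltnW kK)) _ _ aK a'K.
rewrite !divpow_recr // mulrACA IH.
have -> : (a + b * p ^ K + (a' + b' * p ^ K) = (a + a') + (b + b') * p ^ K)%N.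
  by rewrite mulnDl addnACA.
case: ifP => [aa'K | /negbT]; last first.
  (* A carry out of the low digits: the left side vanishes by induction, the right side because
     Lucas yields ['C(a + a' - p ^ K, a')] with [a'] too large. *)
  rewrite -leqNgt => aa'K; rewrite mul0r; case: ifP => // _.
  have -> : ((a + a') + (b + b') * p ^ K = (a + a' - p ^ K) + (b + b').+1 * p ^ K)%N
    by rewrite mulSn; lia.
  rewrite (natr_lucas p_prime charA) //; last by lia.
  by rewrite (@bin_small (a + a' - _)) ?mul0r //; lia.
have xb : x K ^+ b * invfact A p b * (x K ^+ b' * invfact A p b')
        = x K ^+ (b + b') * (invfact A p b * invfact A p b') by rewrite exprD; ring.
rewrite xb (_ : (_ < p ^ K.+1)%N = (b + b' < p)%N); last first.
  by rewrite expnS; apply/idP/idP; nia.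
case: ltnP => bb'p; last by rewrite (expr_ge bb'p (xp _ _)) // mul0r mulr0.
rewrite (natr_lucas p_prime charA) // divpow_recr // (invfactM p_prime charA) //.
ring.
Qed.

(** Lowering the index by one lowers the low part or, if that is zero, borrows from the top digit;
    the borrow is exactly the formula for [D (x K)]. *)
Lemma divpow_deriv D x K : is_derivation D ->
  (forall k, (k < K)%N -> x k ^+ p = 0) ->
  (forall k, (k < K)%N -> D (x k) = divpow x (p ^ k - 1)) ->
  forall i, (i.+1 < p ^ K)%N -> D (divpow x i.+1) = divpow x i.
Proof.
move=> Dder xp Dx; elim: K xp Dx => [|K IH] xp Dx i //.
have xp' k : (k < K)%N -> x k ^+ p = 0 by move=> kK; apply: xp; lia.
have {}IH := IH xp' (fun k kK => Dx k (ltnW kK)).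
have q0 : (0 < p ^ K)%N by rewrite expn_gt0 p_gt0.
move=> /digit_decomp[a [b [aK bp iE]]]; rewrite iE divpow_recr //.
have Df j : D (invfact A p j) = 0 by apply: der_nat.
have Db : D (x K ^+ b * invfact A p b) = if b is b'.+1 then
   x K ^+ b' * invfact A p b' * divpow x (p ^ K - 1) else 0.
  case: b bp {iE} => [|b] bp; first by rewrite expr0 mul1r Df.
  by rewrite mulrC derMc // derX // Dx // -(invfactS p_prime charA (j := b)) //; ring.
rewrite derM // {}Db; case: a aK iE => [|a] aK iE.
  rewrite divpow0 der1 // mul0r addr0 mul1r.
  case: b bp iE => [|b] bp iE //.
  have -> : i = (p ^ K - 1 + b * p ^ K)%N by lia.
  by rewrite divpow_recr; [rewrite mulrC | lia | lia].
rewrite IH // (_ : i = (a + b * p ^ K)%N); last by lia.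
rewrite divpow_recr; [|lia|lia].
case: b bp iE => [|b] bp iE; first by rewrite mulr0 add0r.
(* In the other Leibniz term the low indices [a.+1] and [p ^ K - 1] overflow, so their product is
   zero. *)
rewrite mulrCA (divpowM xp') //; last by lia.
by rewrite ifN ?mulr0 ?add0r //; lia.
Qed.

End DigitProducts.

(** * Sequences of divided powers for one derivation *)

Section DividedPowers.
Variables (A : comPzRingType) (p : nat).
Hypotheses (p_prime : prime p) (charA : p%:R = 0 :> A).
Variables (D : A -> A) (d : option nat).
Hypothesis Dder : is_derivation D.

(* The case n = 1 of an iterative descent. *)
Record dp_sequence (X : nat -> A) : Prop := DpSequence {
  dp_out : forall j, ~~ below_pexp p d j -> X j = 0;
  dp_one : X 0%N = 1;
  dp_deriv : forall j, below_pexp p d j.+1 -> D (X j.+1) = X j;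
  dp_mul : forall i j, below_pexp p d i -> below_pexp p d j ->
    X i * X j = 'C(i + j, j)%:R * X (i + j)%N }.

Definition dp_extend x (j : nat) : A := if below_pexp p d j then divpow p x j else 0.

Lemma dp_extend_exp x k : below d k -> dp_extend x (p ^ k) = x k.
Proof. by move=> dk; rewrite /dp_extend below_pexp_exp // dk divpow_exp. Qed.

Lemma dp_sequence_extend x :
  (forall k, below d k -> x k ^+ p = 0) ->
  (forall k, below d k -> D (x k) = divpow p x (p ^ k - 1)) ->
  dp_sequence (dp_extend x).
Proof.
move=> xp Dx; have p1 := prime_gt1 p_prime.
(* Each identity involves finitely many digits: [K] is the exponent if finite, and otherwise
   [i + j], as [i + j < p ^ (i + j)]. *)
have bnd i j : below_pexp p d i -> below_pexp p d j -> exists K, [/\ (i < p ^ K)%N,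
    (j < p ^ K)%N, forall k, (k < K)%N -> below d k &
    (i + j < p ^ K)%N = below_pexp p d (i + j)].
  case: (d) => [e|] di dj; first by exists e.
  have ij := ltn_expl (i + j) p1.
  by exists (i + j)%N; split=> //; apply: leq_ltn_trans ij; rewrite ?leq_addr ?leq_addl.
split=> [j /negPf dj | | j dj | i j di dj].
- by rewrite /dp_extend dj.
- by rewrite /dp_extend below_pexp0 // divpow0.
- rewrite /dp_extend dj (below_pexpW _ dj) //.
  have [K [jK _ Kd _]] := bnd _ _ dj dj.
  by apply: (divpow_deriv p_prime charA Dder) jK => k /Kd; [apply: xp | apply: Dx].
have [K [iK jK Kd ijK]] := bnd _ _ di dj.
rewrite /dp_extend di dj -ijK (divpowM p_prime charA (K := K)) // => [|k /Kd]; last exact: xp.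
by case: ifP; rewrite ?mulr0.
Qed.

Section Theory.
Variable X : nat -> A.
Hypothesis dpX : dp_sequence X.

Lemma dp_iter_deriv m j : below_pexp p d j ->
  iter m D (X j) = if (m <= j)%N then X (j - m)%N else 0.
Proof.
move=> dj; elim: m => [|m IH]; first by rewrite subn0.
rewrite iterS IH; case: (leqP m j) => [mj|jm]; last first.
  by rewrite der0 // ifN // -leqNgt; lia.
case: ltnP => [mj'|jm]; last first.
  have -> : (j - m = 0)%N by lia.
  by rewrite (dp_one dpX) der1.
have e : (j - m = (j - m.+1).+1)%N by lia.
by rewrite e (dp_deriv dpX) // -e (below_pexpW _ dj) // leq_subr.
Qed.

Lemma dp_expr j m : below_pexp p d j -> exists k, X j ^+ m = k%:R * X (m * j)%N.
Proof.
move=> dj; elim: m => [|m [k IH]]; first by exists 1%N; rewrite (dp_one dpX) mulr1.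
case dmj : (below_pexp p d (m * j)); last first.
  by exists 0%N; rewrite exprS IH (dp_out dpX (negbT dmj)) !mulr0 mul0r.
exists (k * 'C(j + m * j, m * j))%N.
by rewrite exprS IH mulrCA (dp_mul dpX) // natrM mulrA mulSn.
Qed.

(** The power is a multiple of ['C(p * j, j)], and cancelling [j] in [j * 'C(p * j, j) = p * j *
    'C(p * j - 1, j - 1)] shows that [p] divides this binomial. *)
Lemma dp_exprp j : (0 < j)%N -> X j ^+ p = 0.
Proof.
move=> j0; have p0 := prime_gt0 p_prime.
case dj : (below_pexp p d j); last by rewrite (dp_out dpX (negbT dj)) expr0n; case: p p0.
have [k kE] := dp_expr p.-1 dj.
rewrite -(prednK p0) exprS kE mulrCA.
case dpj : (below_pexp p d (p.-1 * j)); last by rewrite (dp_out dpX (negbT dpj)) !mulr0.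
rewrite (dp_mul dpX) // -mulSn prednK //.
suff -> : 'C(p * j, p.-1 * j)%:R = 0 :> A by rewrite mul0r mulr0.
apply: (natr_dvdp charA); rewrite -bin_sub; last by rewrite leq_mul2r leq_pred orbT.
have -> : (p * j - p.-1 * j = j)%N by rewrite -mulnBl -subn1 subKn // mul1n.
case: j j0 {dj kE dpj} => // j _; rewrite -(dvdn_pmul2l (ltn0Sn j)) -mul_bin_diag.
by rewrite mulnC dvdn_mulr // mulnC.
Qed.

(** Taylor expansion: the last nonzero derivative is a constant and serves as top coefficient;
    subtracting its term lowers the order by one. *)
Lemma dp_expand M a : (forall j, (j < M)%N -> below_pexp p d j) -> iter M D a = 0 ->
  exists c : nat -> A, [/\ forall j, D (c j) = 0, forall j, (M <= j)%N -> c j = 0 &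
                      a = \sum_(j < M) c j * X j].
Proof.
elim: M a => [|M IH] a dM aM.
  by exists (fun=> 0); split=> [j||]; rewrite ?der0 ?big_ord0.
have dM' : below_pexp p d M by apply: dM.
have D1 : D (iter M D a) = 0 by [].
case: (IH (a - iter M D a * X M)) => [j jM | | c [c1 c2 c3]].
- by apply: dM; lia.
- rewrite iter_derivD // iter_derivN // iter_derivMc // dp_iter_deriv // leqnn subnn.
  by rewrite (dp_one dpX) mulr1 subrr.
exists (fun j => if j == M then iter M D a else c j); split=> [j|j Mj|].
- by case: eqP.
- by rewrite ifN ?c2 //; lia.
rewrite big_ord_recr /= eqxx -[LHS](subrK (iter M D a * X M)) c3; congr (_ + _).
by apply: eq_bigr => j _; rewrite ifN // neq_ltn ltn_ord.
Qed.

Lemma dp_expand_iter M c m : (forall j, D (c j) = 0) ->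
  (forall j, ~~ below_pexp p d j -> c j = 0) ->
  iter m D (\sum_(j < M) c j * X j) =
  \sum_(j < M) c j * if (m <= j)%N then X (j - m)%N else 0.
Proof.
move=> c1 c2; rewrite iter_deriv_sum //; apply: eq_bigr => j _.
rewrite iter_derivMc //; case dj : (below_pexp p d j); first by rewrite dp_iter_deriv.
by rewrite c2 ?dj // !mul0r.
Qed.

(** Applying [iter M D] turns [X M] into 1 and kills the lower terms, which isolates the top
    coefficient. *)
Lemma dp_expand_eq0 M c : (forall j, D (c j) = 0) ->
  (forall j, ~~ below_pexp p d j -> c j = 0) ->
  \sum_(j < M) c j * X j = 0 -> forall j, (j < M)%N -> c j = 0.
Proof.
move=> c1 c2; elim: M => [|M IH] // s0.
have cM : c M = 0.
  have := congr1 (iter M D) s0; rewrite dp_expand_iter // iter_deriv0 //.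
  rewrite big_ord_recr /= leqnn subnn (dp_one dpX) mulr1 big1 ?add0r // => j _.
  by rewrite leqNgt ltn_ord mulr0.
move=> j; rewrite ltnS leq_eqVlt => /orP[/eqP -> // | jM].
by apply: IH jM; move: s0; rewrite big_ord_recr /= cM mul0r addr0.
Qed.

(** The divided-power form of the Dixmier map, in which [X m] replaces the m-th power of a slice
    divided by the factorial of [m]. *)
Definition dp_cst M a := \sum_(m < M) (-1) ^+ m * X m * iter m D a.

(** The sum is [X j] times the binomial expansion of [(1 - 1) ^+ j]. *)
Lemma dp_cstX M j : below_pexp p d j -> (j < M)%N -> dp_cst M (X j) = (j == 0%N)%:R.
Proof.
move=> dj jM; rewrite /dp_cst -(subnKC jM) big_split_ord /= addrC big1 => [|i _].
  rewrite add0r; transitivity (\sum_(m < j.+1) (-1) ^+ m * 'C(j, m)%:R * X j).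
    apply: eq_bigr => m _; have mj : (m <= j)%N by rewrite -ltnS.
    rewrite dp_iter_deriv // mj -!mulrA (dp_mul dpX).
    - by rewrite subnKC // bin_sub.
    - exact: (below_pexpW mj).
    - exact: (below_pexpW (leq_subr _ _)).
  rewrite -mulr_suml; have := exprDn (1 : A) (-1) j.
  under eq_bigr => i _ do rewrite expr1n mul1r -mulr_natr.
  move=> <-; rewrite subrr expr0n.
  by case: j {dj jM} => [|j]; rewrite ?mul0r // (dp_one dpX) mulr1.
by rewrite -iterS dp_iter_deriv // ltnNge leq_addr mulr0.
Qed.

Lemma dp_cstDc M c a : (0 < M)%N -> D c = 0 -> dp_cst M (c + a) = c + dp_cst M a.
Proof.
case: M => // M _ c0; rewrite /dp_cst !big_ord_recl /= expr0 (dp_one dpX) !mul1r -addrA.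
congr (_ + (_ + _)); apply: eq_bigr => m _; rewrite -!iterS (iter_derivD Dder).
by rewrite (iter_deriv_const Dder) ?add0r.
Qed.

Lemma dp_cst_expand M c : (0 < M)%N -> (forall j, D (c j) = 0) ->
  (forall j, ~~ below_pexp p d j -> c j = 0) ->
  dp_cst M (\sum_(j < M) c j * X j) = c 0%N.
Proof.
move=> M0 c1 c2; transitivity (\sum_(j < M) c j * dp_cst M (X j)).
  rewrite /dp_cst; under eq_bigr => m _ do rewrite iter_deriv_sum // mulr_sumr.
  rewrite exchange_big /=; apply: eq_bigr => j _; rewrite mulr_sumr.
  by apply: eq_bigr => m _; rewrite iter_derivMc //; ring.
case: M M0 => // M _; rewrite big_ord_recl /= dp_cstX ?below_pexp0 // mulr1.
rewrite big1 ?addr0 // => i _.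
case di : (below_pexp p d (bump 0 i)); last by rewrite c2 ?di // mul0r.
by rewrite dp_cstX ?mulr0 // /bump /= add1n ltnS.
Qed.

(* An antiderivative of [z] without constant term, by repeated integration by parts. *)
Definition dp_int M z := \sum_(m < M) (-1) ^+ m * X m.+1 * iter m D z.

Lemma dp_int_deriv M z : (0 < M)%N -> below_pexp p d M -> iter M D z = 0 ->
  D (dp_int M z) = z.
Proof.
case: M => // M _ dM zM; rewrite /dp_int (der_by_parts Dder (u := fun m => X m.+1)).
  rewrite zM mulr0 addr0 (dp_deriv dpX) ?(dp_one dpX) ?mul1r //.
  by apply: below_pexpW dM.
by move=> m mM; rewrite (dp_deriv dpX) //; apply: below_pexpW dM.
Qed.

Lemma dp_int_exprp M z : dp_int M z ^+ p = 0.
Proof.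
rewrite sum_exprp // big1 // => m _.
by rewrite !exprMn dp_exprp // mulr0 mul0r.
Qed.

(** The term of index 0 is the antiderivative itself; in the others one derivative undoes the
    integral, and they add up to its negative. *)
Lemma dp_cst_int M z : (0 < M)%N -> below_pexp p d M -> iter M D z = 0 ->
  dp_cst M.+1 (dp_int M z) = 0.
Proof.
move=> M0 dM zM; rewrite /dp_cst big_ord_recl /= expr0 (dp_one dpX) !mul1r.
apply/eqP; rewrite addr_eq0 -sumrN; apply/eqP/eq_bigr => m _.
by rewrite -iterS iterSr dp_int_deriv // /bump /= add1n exprS; ring.
Qed.

End Theory.

(** Strong induction on the index. If [j] is not a power of [p] and has top digit [b] at position
    [k], then [X (p ^ k) * X (j - p ^ k)] is [b] times [X j], and [b] is invertible. *)
Lemma dp_sequence_ext X Y : dp_sequence X -> dp_sequence Y ->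
  (forall k, below d k -> X (p ^ k - 1)%N = Y (p ^ k - 1)%N -> X (p ^ k)%N = Y (p ^ k)%N) ->
  X =1 Y.
Proof.
move=> dpX dpY XY j; have p1 := prime_gt1 p_prime.
elim/ltn_ind: j => j IH.
case dj : (below_pexp p d j); last first.
  by rewrite (dp_out dpX (negbT dj)) (dp_out dpY (negbT dj)).
have [->|j0] := posnP j; first by rewrite (dp_one dpX) (dp_one dpY).
have /andP[qj jq] := trunc_log_bounds p1 j0.
move: (trunc_log p j) qj jq => k qj jq.
have q0 : (0 < p ^ k)%N by rewrite expn_gt0 prime_gt0.
have [jE|jE] := eqVneq j (p ^ k)%N.
  by rewrite jE; apply: XY; [apply: below_pexp_digit dj qj | apply: IH; lia].
have [a [b [aq bp jab]]] := digit_decomp p_prime jq.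
have dq : below_pexp p d (p ^ k) by apply: below_pexpW dj.
have djq : below_pexp p d (j - p ^ k) by apply: below_pexpW dj; apply: leq_subr.
have step Z : dp_sequence Z -> Z (p ^ k)%N * Z (j - p ^ k)%N = b%:R * Z j.
  move=> dpZ; rewrite (dp_mul dpZ) // subnKC // bin_sub //; congr (_ * _).
  have := natr_lucas p_prime charA b 1 aq q0.
  by rewrite add0n mul1n -jab bin0 bin1 mul1r.
(* The inverse of [b] is [(b - 1)! / b!]. *)
have [v vb] : exists v : A, v * b%:R = 1.
  exists (b.-1`!%:R * invfact A p b); apply: etrans (invfactK p_prime charA bp).
  case: b jab {step bp} => [|b] jab; first by lia.
  by rewrite factS natrM mulrC mulrA.
have eq : X (p ^ k)%N * X (j - p ^ k)%N = Y (p ^ k)%N * Y (j - p ^ k)%N.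
  by rewrite !IH //; lia.
transitivity (v * b%:R * X j); first by rewrite vb mul1r.
by rewrite -mulrA -step // eq step // mulrA vb mul1r.
Qed.

End DividedPowers.

Lemma dp_extend_ker (A : comPzRingType) (p : nat) (E : A -> A) d x j :
  prime p -> is_derivation E -> (forall k, below d k -> E (x k) = 0) ->
  E (dp_extend p d x j) = 0.
Proof.
move=> p_prime Eder Ex; rewrite /dp_extend; case: ifP => [dj|_]; last by rewrite der0.
apply: der_prod_eq0 => // k _.
(* Positions with [j < p ^ k] have digit zero, so [x k] occurs only where [below d k] holds. *)
have [kj|jk] := leqP (p ^ k) j; last first.
  by rewrite divn_small // mod0n mul1r der_nat.
by rewrite derM_eq0 ?der_nat ?derX_eq0 // Ex // (below_pexp_digit p_prime dj).
Qed.

(** * Correctness of the construction [xp] *)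

Section Constructions.
Variables (A : comPzRingType) (p : nat).
Hypotheses (p_prime : prime p) (charA : p%:R = 0 :> A).
Variable (D : A -> A).
Hypothesis Dder : is_derivation D.

Let p_gt0 : (0 < p)%N := prime_gt0 p_prime.
Let p_gt1 : (1 < p)%N := prime_gt1 p_prime.
Let pexp_gt0 k : (0 < p ^ k)%N. Proof. by rewrite expn_gt0 p_gt0. Qed.

(** The inner Leibniz terms carry binomials divisible by [p]. *)
Lemma is_derivation_iter_pexp k : is_derivation (iter (p ^ k) D).
Proof.
split=> a b; first exact: iter_derivD.
rewrite iter_derivM // big_ord_recl /= bin0 mul1r subn0.
have := @dvdp_bin_pexp p p_prime k.
have := pexp_gt0 k; move: (p ^ k)%N => [//|q] _ hq.
rewrite big_ord_recr /= big1 => [|i _].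
  by rewrite /bump /= add1n binn subnn mul1r add0r.
by rewrite (natr_dvdp charA) ?mul0r // hq // /bump /= add1n ltnS ltn_ord.
Qed.

Section Descent.
Variable y : nat -> A.
Let x := xp p D y.

Lemma nth_xps k l : (l <= k)%N -> nth 0 (xps p D y k) l = x l.
Proof.
have sz m : size (xps p D y m) = m.+1 by elim: m => //= m IH; rewrite size_rcons IH.
elim: k => [|k IH]; first by rewrite leqn0 => /eqP ->.
rewrite leq_eqVlt => /orP[/eqP -> // | lk].
by rewrite /= nth_rcons sz lk IH.
Qed.

Lemma xpS k : x k.+1 = (-1) ^+ (p - 1) *
  iter (p ^ k - 1) D (divpow p x (p ^ k - 1) * phi p D (x k) k (y k.+1)).
Proof.
rewrite /x /xp /= nth_rcons.
have -> : size (xps p D y k) = k.+1 by elim: k => //= k IH; rewrite size_rcons IH.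
rewrite ltnn eqxx divpow_pred // nth_xps //; congr (_ * iter _ D (_ * _)).
by apply: eq_bigr => l _; rewrite nth_xps // ltnW.
Qed.

(** One further [D] turns the iterate in the recursion for [x k.+1] into the derivation [E]. It
    kills [X (p ^ k - 1)] and sends [w] to a signed top digit factor, so the product acquires its
    missing factor. *)
Lemma xp_spec K : (forall k, (k <= K)%N -> y k ^+ p = 0) ->
  (forall k, (k <= K)%N -> iter (p ^ k) D (y k) = 1) ->
  x K ^+ p = 0 /\ D (x K) = divpow p x (p ^ K - 1).
Proof.
elim/ltn_ind: K => -[|k] IH yp y1.
  by rewrite expn0 subnn divpow0 // (yp 0%N) //; split=> //; apply: (y1 0%N).
have x_spec l : (l <= k)%N -> x l ^+ p = 0 /\ D (x l) = divpow p x (p ^ l - 1).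
  by move=> lk; apply: IH => // m ml; [apply: yp | apply: y1]; lia.
(* The elements up to [x k] already form a sequence of exponent [k.+1], which computes the iterates
   of [D] on them. *)
pose X := dp_extend p (Some k.+1) x.
have dpX : dp_sequence p D (Some k.+1) X.
  by apply: dp_sequence_extend => //= l; rewrite ltnS => /x_spec[].
have q0 := pexp_gt0 k.
have qq : (p ^ k < p ^ k.+1)%N by rewrite ltn_exp2l.
have XE j : (j < p ^ k.+1)%N -> X j = divpow p x j by rewrite /X /dp_extend /= => ->.
set E := iter (p ^ k) D; have Eder : is_derivation E := is_derivation_iter_pexp k.
have Exk : E (x k) = 1.
  have -> : x k = X (p ^ k)%N by rewrite XE // divpow_exp.
  by rewrite /E (dp_iter_deriv p_prime Dder dpX) //= leqnn subnn (dp_one dpX).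
have EX : E (X (p ^ k - 1)%N) = 0.
  by rewrite /E (dp_iter_deriv p_prime Dder dpX) ?ifN //=; lia.
set z := y k.+1; set w := phi p D (x k) k z.
pose u j := x k ^+ j * invfact A p j.
have wE : w = \sum_(j < p.-1.+1) (-1) ^+ j * u j * iter j E z.
  rewrite prednK //; apply: eq_bigr => j _.
  by rewrite mulnC iterM /u !mulrA.
(* Integration by parts with respect to [E] leaves the last boundary term, which contains the
   derivative of [z] of order [p ^ k.+1], equal to 1. *)
have Ew : E w = (-1) ^+ (p - 1) * (x k ^+ (p - 1) * invfact A p (p - 1)).
  rewrite wE der_by_parts // => [|m mp].
    have -> : E (u 0%N) = 0 by rewrite /u expr0 mul1r der_nat.
    rewrite prednK // subn1 mul0r add0r.
    by rewrite -iterM -expnS y1 // mulr1.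
  rewrite /u mulrC (derMc Eder) ?(der_nat Eder) // (derX Eder) Exk.
  rewrite -(invfactS p_prime charA (j := m)); last lia.
  ring.
(* The first term has [z ^+ p = 0]; all others contain a positive power of [x k]. *)
have wp : w ^+ p = 0.
  rewrite sum_exprp // big1 // => -[[|j] jp] _ /=.
    by rewrite muln0 /= !exprMn yp // mulr0.
  rewrite !exprMn -(exprM (x k)) mulnC exprM.
  by have [-> _] := x_spec k (leqnn k); rewrite expr0n !(mulr0, mul0r).
rewrite xpS -/z -/w -XE; last lia.
split.
  (* By Frobenius each Leibniz term is treated alone: either it contains some [X m] with [m > 0], or
     [w] stands undifferentiated. *)
  rewrite exprMn iter_derivM // sum_exprp // big1 ?mulr0 // => j _.
  rewrite !exprMn (dp_iter_deriv p_prime Dder dpX) /=; last lia.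
  have -> : (j <= p ^ k - 1)%N by rewrite -ltnS.
  have [->|j0] := posnP (p ^ k - 1 - j); first by rewrite /= wp !mulr0.
  by rewrite (dp_exprp p_prime charA dpX) // mul0r mulr0.
rewrite (derMc Dder) ?(der_sign Dder) // -iterS -subSn // subSS subn0 -/E.
rewrite (derM Eder) EX mul0r addr0 Ew.
rewrite [in RHS]divpow_pred // big_ord_recr /= -divpow_pred // XE; last lia.
(* The sign in the recursion cancels the one coming from [Ew]. *)
have := sqrr_sign A (p - 1); move: ((-1) ^+ (p - 1)) (_ * invfact _ _ _) (divpow _ _ _).
by move=> s b a s2; rewrite mulrCA (mulrA s s) -expr2 s2 mul1r.
Qed.

(** Meant for the other derivations of the tuple as [E]: they kill every ingredient of the recursion
    and commute with [D]. *)
Lemma xp_ker (E : A -> A) K : is_derivation E -> (forall a, E (D a) = D (E a)) ->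
  (forall k, (k <= K)%N -> E (y k) = 0) -> E (x K) = 0.
Proof.
move=> Eder ED; elim/ltn_ind: K => -[|k] IH yE; first exact: (yE 0%N).
have xE l : (l <= k)%N -> E (x l) = 0.
  by move=> lk; apply: IH => // m ml; apply: yE; lia.
have ker_iter m a : E a = 0 -> E (iter m D a) = 0.
  by move=> Ea; rewrite (iter_commute m a ED) Ea iter_deriv0.
rewrite xpS (derM_eq0 Eder) ?(der_sign Eder) // ker_iter // (derM_eq0 Eder) //.
  rewrite divpow_pred // der_prod_eq0 // => l _.
  by rewrite (derM_eq0 Eder) ?(der_nat Eder) // (derX_eq0 Eder) // xE // ltnW.
apply: der_sum_eq0 => // j _.
by rewrite !(derM_eq0 Eder) ?(der_sign Eder) ?(der_nat Eder) ?(derX_eq0 Eder) ?xE ?ker_iter ?yE.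
Qed.

End Descent.

(** * Sequences with prescribed constant terms *)

Section Lift.
Variables (d : option nat) (X lam : nat -> A).
Hypothesis dpX : dp_sequence p D d X.

Definition lift_elt k z := lam k + dp_int D X (p ^ k) z.

(** Recursion on the product itself lets [lift k] depend on all earlier elements while staying
    structural. *)
Fixpoint lift_prod k := if k is k'.+1 then
  lift_prod k' * (lift_elt k' (lift_prod k') ^+ (p - 1) * invfact A p (p - 1)) else 1.

Definition lift k := lift_elt k (lift_prod k).

Lemma lift_prodE k : lift_prod k = divpow p lift (p ^ k - 1).
Proof.
rewrite divpow_pred //; elim: k => [|k IH]; first by rewrite big_ord0.
by rewrite big_ord_recr /= -IH.
Qed.

Hypothesis lamD : forall k, below d k -> D (lam k) = 0.
Hypothesis lamp : forall k, below d k -> lam k ^+ p = 0.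

(** The earlier elements form a sequence of exponent [k] with [lift_prod k] as its entry
    [p ^ k - 1]. This is the vanishing that [dp_int] needs to be an antiderivative. *)
Lemma iter_lift_prod k :
  (forall l, (l < k)%N -> lift l ^+ p = 0 /\ D (lift l) = divpow p lift (p ^ l - 1)) ->
  iter (p ^ k) D (lift_prod k) = 0.
Proof.
move=> IH; have q0 := pexp_gt0 k.
have dpk : dp_sequence p D (Some k) (dp_extend p (Some k) lift).
  by apply: dp_sequence_extend => //= l /IH[].
have := dp_iter_deriv p_prime Dder dpk (p ^ k) (j := p ^ k - 1).
by rewrite /dp_extend /= -lift_prodE (_ : p ^ k - 1 < p ^ k)%N ?ifN; [apply|lia..].
Qed.

Lemma lift_spec k : below d k -> lift k ^+ p = 0 /\ D (lift k) = divpow p lift (p ^ k - 1).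
Proof.
elim/ltn_ind: k => k IH dk.
have z0 : iter (p ^ k) D (lift_prod k) = 0.
  by apply: iter_lift_prod => l lk; apply: IH => //; apply: belowW dk; apply: ltnW.
split; first by rewrite exprDp // lamp // (dp_int_exprp p_prime charA dpX) addr0.
rewrite (derD Dder) lamD // add0r (dp_int_deriv Dder dpX) ?lift_prodE ?below_pexp_exp //.
by rewrite -lift_prodE.
Qed.

Lemma lift_cst k : below d k -> dp_cst D X (p ^ k).+1 (lift k) = lam k.
Proof.
move=> dk; have z0 : iter (p ^ k) D (lift_prod k) = 0.
  by apply: iter_lift_prod => l lk; apply: lift_spec; apply: belowW dk; apply: ltnW.
have := dp_cst_int Dder dpX (pexp_gt0 k) (z := lift_prod k).
rewrite below_pexp_exp // => /(_ dk z0) int0.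
by rewrite (dp_cstDc Dder dpX) ?lamD ?int0 ?addr0.
Qed.

Lemma lift_ker (E : A -> A) k : is_derivation E -> (forall a, E (D a) = D (E a)) ->
  (forall j, E (X j) = 0) -> (forall l, below d l -> E (lam l) = 0) ->
  below d k -> E (lift k) = 0.
Proof.
move=> Eder ED EX Elam; elim/ltn_ind: k => k IH dk.
have Ez : E (lift_prod k) = 0.
  rewrite lift_prodE divpow_pred // der_prod_eq0 // => l _.
  rewrite (derM_eq0 Eder) ?(der_nat Eder) // (derX_eq0 Eder) // IH //.
  by apply: belowW dk; apply: ltnW.
rewrite (derD Eder) Elam // add0r der_sum_eq0 // => m _.
by rewrite !(derM_eq0 Eder) ?(der_sign Eder) // (iter_commute m _ ED) Ez iter_deriv0.
Qed.

End Lift.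
End Constructions.

(** * Multi-indices supported on one axis *)

Section MultiIndices.
Variables (A : comPzRingType) (p n : nat).
Hypothesis p_prime : prime p.
Implicit Types (i : 'I_n) (al be : mindex n).

Lemma miunit0 i : miunit i 0 = mi0 n.
Proof. by apply/ffunP => k; rewrite !ffunE if_same. Qed.

Lemma miaddunit i a b : miadd (miunit i a) (miunit i b) = miunit i (a + b).
Proof. by apply/ffunP => k; rewrite !ffunE; case: eqP. Qed.

Lemma inI_miunit d i m : inI p d (miunit i m) = below_pexp p (d i) m.
Proof.
apply/forallP/idP => [/(_ i)|dm k]; first by rewrite ffunE eqxx.
by rewrite ffunE; case: eqP => [->|_] //; apply: below_pexp0.
Qed.

Lemma mibinom_unit i a b : mibinom A (miunit i a) (miunit i b) = 'C(a + b, b)%:R.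
Proof.
rewrite /mibinom (bigD1 i) //= !ffunE eqxx big1 ?muln1 // => k /negPf ki.
by rewrite !ffunE ki bin0.
Qed.

Lemma prod_miunit (X : 'I_n -> nat -> A) i m : (forall k, X k 0%N = 1) ->
  \prod_k X k (miunit i m k) = X i m.
Proof.
move=> X0; rewrite (bigD1 i) //= ffunE eqxx big1 ?mulr1 // => k /negPf ki.
by rewrite ffunE ki.
Qed.

Lemma dpow_miunit (dl : 'I_n -> A -> A) i m a : dpow dl (miunit i m) a = iter m (dl i) a.
Proof.
have gen s : uniq s ->
    foldr (fun k f => iter (miunit i m k) (dl k) \o f) id s a
    = if i \in s then iter m (dl i) a else a.
  elim: s => //= k s IH /andP[ks us]; rewrite IH // ffunE in_cons eq_sym.
  by case: eqP ks => [->|_] //= /negPf ->.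
by rewrite /dpow gen ?enum_uniq // mem_enum.
Qed.

End MultiIndices.

(** * Descents in several variables, reduced to one variable *)

Section Descents.
Variables (A : comPzRingType) (p : nat).
Hypotheses (p_prime : prime p) (charA : p%:R = 0 :> A).
Variables (n : nat) (dl : 'I_n -> A -> A).
Hypothesis der : forall i, is_derivation (dl i).
Hypothesis comm : forall i j a, dl i (dl j a) = dl j (dl i a).
Variable d : 'I_n -> option nat.
Implicit Types (i : 'I_n) (al be : mindex n) (x y : mindex n -> A).

Lemma descent_dp_sequence y i : iter_descent p dl d y ->
  dp_sequence p (dl i) (d i) (fun m => y (miunit i m)).
Proof.
move=> [[y_out y_one y_der] y_iter]; split=> [m dm | | m dm | a b da db].
- by rewrite y_out // inI_miunit.
- by rewrite miunit0.
- have := y_der (miunit i 1) (miunit i m.+1); rewrite inI_miunit // dpow_miunit /= => -> //.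
  rewrite ifT; last by apply/forallP => k; rewrite !ffunE; case: eqP.
  by congr y; apply/ffunP => k; rewrite !ffunE; case: eqP => // _; rewrite subn1.
- by rewrite y_iter ?inI_miunit // miaddunit mibinom_unit.
Qed.

Lemma descent_ker y i k m : iter_descent p dl d y -> k != i -> dl k (y (miunit i m)) = 0.
Proof.
move=> [[y_out _ y_der] _] ki.
case dm : (inI p d (miunit i m)); last by rewrite y_out ?dm // der0.
have := y_der (miunit k 1) _ dm; rewrite dpow_miunit /= => ->.
rewrite ifN //; apply/forallPn; exists k.
by rewrite !ffunE eqxx (negPf ki).
Qed.

(** The axes are added one at a time. The supports are disjoint, so every binomial that occurs is
    ['C(m, 0)] or ['C(m, m)]. *)
Lemma descent_prod y al : iter_descent p dl d y -> inI p d al ->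
  y al = \prod_i y (miunit i (al i)).
Proof.
move=> [[_ y_one _] y_iter] dal.
pose res (s : seq 'I_n) : mindex n := [ffun i => if i \in s then al i else 0%N].
have dres s : inI p d (res s).
  apply/forallP => i; rewrite ffunE; case: ifP => _; last exact: below_pexp0.
  exact: (forallP dal).
have gen s : uniq s -> y (res s) = \prod_(i <- s) y (miunit i (al i)).
  elim: s => [_|k s IH /= /andP[ks us]].
    by rewrite big_nil -y_one; congr y; apply/ffunP => i; rewrite !ffunE.
  rewrite big_cons -IH // y_iter ?inI_miunit ?(forallP dal) //.
  rewrite (_ : mibinom A _ _ = 1) ?mul1r.
    congr y; apply/ffunP => i; rewrite !ffunE in_cons.
    by case: eqP => [->|] //=; rewrite (negPf ks) addn0.
  rewrite /mibinom big1 // => i _; rewrite !ffunE.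
  by case: eqP => [->|]; rewrite ?(negPf ks) ?bin0 ?add0n ?binn.
rewrite -big_enum -(gen (enum 'I_n)) ?enum_uniq //.
by congr y; apply/ffunP => i; rewrite ffunE mem_enum.
Qed.

(** For [dl k] all factors except the one of index [k] are constants, and commutativity preserves
    this after other derivations have acted. *)
Lemma dpow_prod (F : 'I_n -> A) al : (forall i k, k != i -> dl k (F i) = 0) ->
  dpow dl al (\prod_i F i) = \prod_i iter (al i) (dl i) (F i).
Proof.
move=> F0.
have gen s : uniq s ->
    foldr (fun k f => iter (al k) (dl k) \o f) id s (\prod_i F i)
    = \prod_i (if i \in s then iter (al i) (dl i) (F i) else F i).
  elim: s => //= k s IH /andP[ks us]; rewrite IH //.
  rewrite (bigD1 k) //= (negPf ks) mulrC iter_derivMc //; last first.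
    apply: der_prod_eq0 => // i ik; case: ifP => _; last by rewrite F0 // eq_sym.
    by rewrite (iter_commute _ _ (comm k i)) F0 ?iter_deriv0 // eq_sym.
  rewrite mulrC [RHS](bigD1 k) //= in_cons eqxx; congr (_ * _).
  by apply: eq_bigr => i /negPf ik; rewrite in_cons ik.
rewrite /dpow gen ?enum_uniq //.
by apply: eq_bigr => i _; rewrite mem_enum.
Qed.

Lemma descent_of_dp_sequences (X : 'I_n -> nat -> A) y :
  (forall i, dp_sequence p (dl i) (d i) (X i)) ->
  (forall i k m, k != i -> dl k (X i m) = 0) ->
  (forall al, y al = \prod_i X i (al i)) ->
  iter_descent p dl d y.
Proof.
move=> dpX X0 yE.
have out al : ~~ inI p d al -> y al = 0.
  rewrite yE; move/forallPn => [i di]; by rewrite (bigD1 i) //= (dp_out (dpX i) di) mul0r.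
split; first split=> //.
- by rewrite yE big1 // => i _; rewrite ffunE (dp_one (dpX i)).
- move=> al be dbe; rewrite !yE dpow_prod => [|i k ki]; last exact: X0.
  under eq_bigr => i _ do rewrite (dp_iter_deriv p_prime (der i) (dpX i)) ?(forallP dbe) //.
  case: ifP => [/forallP le|/negbT/forallPn[i le]].
    by apply: eq_bigr => i _; rewrite ffunE le.
  by rewrite (bigD1 i) //= (negPf le) mul0r.
move=> al be dal dbe; rewrite !yE -big_split /= /mibinom natr_prod -big_split /=.
apply: eq_bigr => i _.
by rewrite (dp_mul (dpX i)) ?(forallP dal) ?(forallP dbe) // ffunE.
Qed.

Lemma lincomb_widen x i c N M : (N <= M)%N -> (forall m, (N <= m)%N -> c m = 0) ->
  lincomb x i c N = lincomb x i c M.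
Proof.
move=> NM c0; rewrite /lincomb -(subnKC NM) big_split_ord /= [X in _ = _ + X]big1 ?addr0 //.
by move=> m _; rewrite c0 ?mul0r // leq_addr.
Qed.

(** * Coordinates relative to a reference descent *)

Section Basis.
Variables (x : mindex n -> A) (i : 'I_n).
Hypothesis x_descent : iter_descent p dl d x.
Let X m := x (miunit i m).
Let dpX : dp_sequence p (dl i) (d i) X := descent_dp_sequence i x_descent.

Lemma lincomb_inN c N : good_coef p dl d i c N -> inN p dl d i (lincomb x i c N).
Proof.
move=> [c1 c2 c3]; have it m := dp_expand_iter p_prime (der i) dpX N m c1 c3.
rewrite /inN; case E : (d i) => [e|]; last first.
  exists N; rewrite it big1 // => j _.
  by rewrite leqNgt ltn_ord mulr0.
rewrite it big1 // => j _; case: leqP => [ej|_]; last by rewrite mulr0.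
by rewrite c3 ?mul0r // E /= -leqNgt.
Qed.

Lemma inN_lincomb a : inN p dl d i a ->
  exists c N, good_coef p dl d i c N /\ a = lincomb x i c N.
Proof.
move=> aN; have [M [MN M0]] : exists M, (forall j, (j < M)%N -> below_pexp p (d i) j) /\
    iter M (dl i) a = 0.
  move: aN; rewrite /inN; case: (d i) => [e|] h; first by exists (p ^ e)%N.
  by case: h => m h; exists m.
have MN' j : ~~ below_pexp p (d i) j -> (M <= j)%N by rewrite leqNgt; apply/contra/MN.
have [c [c1 c2 c3]] := dp_expand p_prime (der i) dpX MN M0.
by exists c, M; split=> //; split=> // j /MN'; apply: c2.
Qed.

Lemma lincomb_inj c N c' N' : good_coef p dl d i c N -> good_coef p dl d i c' N' ->
  lincomb x i c N = lincomb x i c' N' -> forall j, c j = c' j.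
Proof.
move=> [c1 c2 c3] [c1' c2' c3'].
rewrite (lincomb_widen x i (leq_maxl N N') c2) (lincomb_widen x i (leq_maxr N N') c2').
move=> eq j; apply/eqP; rewrite -subr_eq0; apply/eqP.
have [jM|jM] := ltnP j (maxn N N'); last first.
  by rewrite geq_max in jM; case/andP: jM => h h'; rewrite c2 // c2' // subrr.
apply: (dp_expand_eq0 p_prime (der i) dpX (c := fun m => c m - c' m)) jM => [m|m dm|].
- by rewrite derD // derN // c1 c1' subrr.
- by rewrite c3 // c3' // subrr.
- by under eq_bigr => m _ do rewrite mulrBl; rewrite sumrB -/(lincomb x i c _) eq subrr.
Qed.

Lemma lambda_rel_uniq j y c c' :
  lambda_rel p dl d x i j y c -> lambda_rel p dl d x i j y c' -> c = c'.
Proof.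
move=> [_ [f [N [fN <- yE]]]] [_ [f' [N' [fN' <- yE']]]].
by apply: (lincomb_inj fN fN'); rewrite -yE -yE'.
Qed.

(** The entry at [p ^ j] is killed by [(p ^ j).+1] derivatives, so its expansion stops at index
    [p ^ j], still within bounds, and [dp_cst] reads off the constant term. *)
Lemma lambda_rel_cst j y : iter_descent p dl d y -> below (d i) j ->
  lambda_rel p dl d x i j y (dp_cst (dl i) X (p ^ j).+1 (y (miunit i (p ^ j)))).
Proof.
move=> y_descent dj; have dpY := descent_dp_sequence i y_descent.
have dq : below_pexp p (d i) (p ^ j) by rewrite below_pexp_exp.
have MN m : (m < (p ^ j).+1)%N -> below_pexp p (d i) m.
  by rewrite ltnS => mq; apply: below_pexpW dq.
have M0 : iter (p ^ j).+1 (dl i) (y (miunit i (p ^ j))) = 0.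
  by rewrite (dp_iter_deriv p_prime (der i) dpY) // ltnn.
have MN' m : ~~ below_pexp p (d i) m -> (p ^ j < m)%N by rewrite ltnNge; apply/contra/MN.
have [c [c1 c2 c3]] := dp_expand p_prime (der i) dpX MN M0.
have c4 m : ~~ below_pexp p (d i) m -> c m = 0 by move/MN'; apply: c2.
rewrite c3 (dp_cst_expand p_prime (der i) dpX) //.
by split=> //; exists c, (p ^ j).+1.
Qed.

(** For [k != i], [dl k] kills the entry and acts on the coefficients only, so uniqueness of
    coefficients makes it kill each of them. In the p-th power, Frobenius leaves only the constant
    term. *)
Lemma lambda_rel_mem j y c : iter_descent p dl d y -> below (d i) j ->
  lambda_rel p dl d x i j y c -> (forall k, dl k c = 0) /\ c ^+ p = 0.
Proof.
move=> y_descent dj [c0 [f [N [[f1 f2 f3] <- yE]]]]; split=> [k|].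
  have [->|ki] := eqVneq k i; first exact: f1.
  have h : lincomb x i (fun m => dl k (f m)) N = lincomb x i (fun=> 0) N.
    rewrite [RHS]big1 => [|m _]; last by rewrite mul0r.
    have := congr1 (dl k) yE; rewrite (descent_ker _ y_descent ki) => ->.
    rewrite der_sum //; apply: eq_bigr => m _.
    by rewrite derM // (descent_ker _ x_descent ki) mulr0 add0r.
  apply: (lincomb_inj _ _ h 0%N); split=> // m; rewrite ?der0 //.
  - by rewrite comm f1 der0.
  - by move/f2 ->; rewrite der0.
  - by move/f3 ->; rewrite der0.
have := congr1 (fun a => a ^+ p) yE.
have dpY := descent_dp_sequence i y_descent.
rewrite (dp_exprp p_prime charA dpY); last by rewrite expn_gt0 prime_gt0.
(* Widening to [N.+1] makes index 0 available even when [N] is zero. *)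
rewrite (@lincomb_widen _ _ _ N N.+1) // sum_exprp // big_ord_recl /= big1 => [|m _].
  by rewrite addr0 exprMn [X in _ * X ^+ _](dp_one dpX) expr1n mulr1.
by rewrite exprMn [X in _ * X](dp_exprp p_prime charA dpX) // mulr0.
Qed.

End Basis.

(** On each axis, equality at [p ^ k - 1] makes the difference at [p ^ k] a constant, and equal
    constant terms force it to be zero. *)
Lemma lambda_rel_inj x y y' : iter_descent p dl d x ->
  iter_descent p dl d y -> iter_descent p dl d y' ->
  (forall i j, below (d i) j -> exists c,
     lambda_rel p dl d x i j y c /\ lambda_rel p dl d x i j y' c) ->
  forall al, y al = y' al.
Proof.
move=> x_descent y_descent y'_descent lam al.
case dal : (inI p d al); last first.
  by case: y_descent y'_descent => -[out _ _ _] [[out' _ _] _]; rewrite out ?out' ?dal.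
rewrite (descent_prod y_descent dal) (descent_prod y'_descent dal).
apply: eq_bigr => i _; move: (al i).
have dpX := descent_dp_sequence i x_descent.
have dpY := descent_dp_sequence i y_descent.
have dpY' := descent_dp_sequence i y'_descent.
apply: (dp_sequence_ext p_prime charA dpY dpY') => k dk eq.
set a := y _; set b := y' _.
have [c [lc lc']] := lam i k dk.
have := lambda_rel_uniq x_descent lc (lambda_rel_cst x_descent y_descent dk).
rewrite (lambda_rel_uniq x_descent lc' (lambda_rel_cst x_descent y'_descent dk)) -/a -/b.
have q0 : (0 < p ^ k)%N by rewrite expn_gt0 prime_gt0.
have dq : below_pexp p (d i) (p ^ k) by rewrite below_pexp_exp.
have D0 : dl i (a - b) = 0.
  have qE : (p ^ k)%N = (p ^ k - 1).+1 by lia.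
  rewrite derD // derN // /a /b.
  have := dp_deriv dpY (j := p ^ k - 1); have := dp_deriv dpY' (j := p ^ k - 1).
  by rewrite -qE => -> // -> //; rewrite eq subrr.
have := dp_cstDc (der i) dpX (M := (p ^ k).+1) b isT D0; rewrite subrK => ->.
by move/(canLR (addrK _)); rewrite subrr => /esym/subr0_eq.
Qed.

Lemma lambda_rel_surj x (lam : 'I_n -> nat -> A) : iter_descent p dl d x ->
  (forall i j, below (d i) j -> (forall k, dl k (lam i j) = 0) /\ lam i j ^+ p = 0) ->
  exists y, iter_descent p dl d y /\
    forall i j, below (d i) j -> lambda_rel p dl d x i j y (lam i j).
Proof.
move=> x_descent lamP.
have dpX i := descent_dp_sequence i x_descent.
(* On each axis [x] serves as reference sequence, so the constant terms measured against [x] are the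
   prescribed ones. *)
pose z i := lift p (dl i) (fun m => x (miunit i m)) (lam i).
have zP i k : below (d i) k -> z i k ^+ p = 0 /\ dl i (z i k) = divpow p (z i) (p ^ k - 1).
  by apply: (lift_spec p_prime charA (der i) (dpX i)) => j /lamP[].
have y_descent : iter_descent p dl d (fun al => \prod_i dp_extend p (d i) (z i) (al i)).
  apply: (descent_of_dp_sequences (X := fun i => dp_extend p (d i) (z i))) => // [i|i k m ki].
    by apply: dp_sequence_extend => // k /zP[].
  apply: dp_extend_ker => // j dj.
  apply: (lift_ker p_prime (der i) (d := d i)) => // [m'|l /lamP[] //].
  exact: descent_ker.
exists (fun al => \prod_i dp_extend p (d i) (z i) (al i)); split=> // i j dj.
have := lambda_rel_cst x_descent y_descent dj.
rewrite (prod_miunit (X := fun i => dp_extend p (d i) (z i))) => [|k]; last first.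
  by rewrite /dp_extend below_pexp0 // divpow0.
rewrite dp_extend_exp // (lift_cst p_prime charA (der i) (dpX i)) // => k /lamP[] //.
Qed.

Lemma xfam_descent (Y : 'I_n -> nat -> A) :
  (forall i k, below (d i) k -> Y i k ^+ p = 0) ->
  (forall i k, below (d i) k -> iter (p ^ k) (dl i) (Y i k) = 1) ->
  (forall i j k, below (d i) k -> j != i -> dl j (Y i k) = 0) ->
  iter_descent p dl d (xfam p dl d Y).
Proof.
move=> Yp Y1 Y0; pose z i := xp p (dl i) (Y i).
have zP i k : below (d i) k -> z i k ^+ p = 0 /\ dl i (z i k) = divpow p (z i) (p ^ k - 1).
  by move=> dk; apply: xp_spec => // l lk; [apply: Yp | apply: Y1]; apply: belowW dk.
apply: (descent_of_dp_sequences (X := fun i => dp_extend p (d i) (z i))) => [i|i k m ki|al].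
- by apply: dp_sequence_extend => // k /zP[].
- apply: dp_extend_ker => // j dj; apply: xp_ker => // l lj.
  by apply: Y0 => //; apply: belowW dj.
rewrite /xfam; case: ifP => [/forallP dal|/negbT/forallPn[i di]].
  by apply: eq_bigr => i _; rewrite /dp_extend dal.
by rewrite (bigD1 i) //= /dp_extend (negPf di) mul0r.
Qed.

End Descents.

Unset Implicit Arguments.

Theorem theorem2p10 (A : comPzRingType) (p : nat) (p_prime : prime p) (charA : p%:R = 0 :> A)
  (n : nat) (dl : 'I_n -> A -> A)
  (der : forall i, is_derivation (dl i))
  (comm : forall i j a, dl i (dl j a) = dl j (dl i a))
  (d : 'I_n -> option nat) (Y : 'I_n -> nat -> A)
  (Ynil : forall i k, below (d i) k -> Y i k ^+ p = 0)
  (Yone : forall i k, below (d i) k -> iter (p ^ k) (dl i) (Y i k) = 1)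
  (Yker : forall i j k, below (d i) k -> j != i -> dl j (Y i k) = 0) :
  (* (1) *)
  iter_descent p dl d (xfam p dl d Y) /\
  (* (2) *)
  (forall x' : mindex n -> A, iter_descent p dl d x' ->
     (* N_i = A^{delta_i} (+) m_i : (x'^[j e_i])_{j < p^(d_i)} is an
        A^{delta_i}-basis of N_i *)
     (forall i : 'I_n,
        (forall c N, good_coef p dl d i c N -> inN p dl d i (lincomb x' i c N)) /\
        (forall a, inN p dl d i a -> exists c N, good_coef p dl d i c N /\ a = lincomb x' i c N) /\
        (forall c N c' N', good_coef p dl d i c N -> good_coef p dl d i c' N' ->
           lincomb x' i c N = lincomb x' i c' N' -> forall j, c j = c' j)) /\
     (* r_d is well defined with values in C(delta, d) *)
     (forall y, iter_descent p dl d y -> forall i j, below (d i) j ->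
        (exists c, lambda_rel p dl d x' i j y c) /\
        (forall c, lambda_rel p dl d x' i j y c ->
           (forall k, dl k c = 0) /\ c ^+ p = 0)) /\
     (* r_d is injective *)
     (forall y y', iter_descent p dl d y -> iter_descent p dl d y' ->
        (forall i j, below (d i) j ->
           exists c, lambda_rel p dl d x' i j y c /\ lambda_rel p dl d x' i j y' c) ->
        forall al, y al = y' al) /\
     (* r_d is onto C(delta, d) *)
     (forall lam : 'I_n -> nat -> A,
        (forall i j, below (d i) j -> (forall k, dl k (lam i j) = 0) /\ lam i j ^+ p = 0) ->
        exists y, iter_descent p dl d y /\
          forall i j, below (d i) j -> lambda_rel p dl d x' i j y (lam i j))) /\
  (* (3) *)
  ((forall a : A, (forall k, dl k a = 0) -> forall m, a ^+ m = 0 -> a = 0) ->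
   forall y, iter_descent p dl d y -> forall al, y al = xfam p dl d Y al).
Proof.
have x_descent := xfam_descent p_prime charA der comm Ynil Yone Yker.
split=> //; split=> [x' x'_descent | red y y_descent].
  split; first by move=> i; split; [exact: lincomb_inN | split; [exact: inN_lincomb |
    move=> c N c' N'; exact: lincomb_inj]].
  split; first by move=> y y_descent i j dj; split=> [|c];
    [eexists; apply: lambda_rel_cst | apply: lambda_rel_mem].
  split; first by move=> y y'; apply: lambda_rel_inj.
  by move=> lam; apply: lambda_rel_surj.
(* With the constructed family as reference, every coordinate of a descent is a constant with zero
   p-th power, hence 0 by reducedness; injectivity then gives uniqueness. *)
apply: (lambda_rel_inj p_prime charA der x_descent) => // i j dj; exists 0.
have lam0 z : iter_descent p dl d z -> lambda_rel p dl d (xfam p dl d Y) i j z 0.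
  move=> z_descent; have := lambda_rel_cst p_prime der x_descent z_descent dj.
  set c := dp_cst _ _ _ _ => lc.
  have [ck cp] := lambda_rel_mem p_prime charA der comm x_descent z_descent dj lc.
  by rewrite -(red c ck p cp).
by split; apply: lam0.
Qed.
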